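(* Let $L$ be a finite-dimensional Lie algebra over $\mathbb{F}$, let $P(L)$ be its perfect radical, and let $S$ be a Levi factor of $L$. Then: (a) $S\subseteq P(L)$. (b) $S$ is also a Levi factor of $P(L)$. (c) $R(P(L)) = R(L)\cap P(L)\subseteq N(P(L))$. Thus $R(P(L))=N(P(L))$, and $R(P(L))$ is nilpotent.
   Context: $\mathbb{F}$ denotes either the field of real numbers or the field of complex numbers. An ideal $I$ of a Lie algebra $L$ is called a perfect ideal if $[I,I]=I$, where $[I,I]$ is the linear span of all brackets of elements of $I$; the zero ideal is a perfect ideal. The sum of two perfect ideals is a perfect ideal, so a finite-dimensional Lie algebra $L$ has a largest perfect ideal; it is called the perfect radical of $L$ and denoted $P(L)$. For a finite-dimensional Lie algebra $M$, $R(M)$ denotes its radical (largest solvable ideal) and $N(M)$ its nilradical (largest nilpotent ideal). A Levi factor of $M$ is a Lie subalgebra $S$ of $M$ that is semisimple (has no nonzero solvable ideals) and such that $M$ is the semidirect sum of $R(M)$ and $S$, i.e. $M=R(M)+S$ with $R(M)\cap S=0$; when $M$ is solvable, $S=0$ is the Levi factor. *)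

(* Defs.v *)
From HB Require Import structures.
From mathcomp Require Import all_boot all_order all_algebra.
From mathcomp Require Import boolp classical_sets reals.
From mathcomp.real_closed Require Import complex.

Set Implicit Arguments.
Unset Strict Implicit.
Unset Printing Implicit Defensive.

Import GRing.Theory.
Local Open Scope ring_scope.

Inductive real_or_complex (R : realType) : fieldType -> Prop :=
  | is_real : real_or_complex R R
  | is_complex : real_or_complex R (complex R).

HB.mixin Record Vector_isLieAlgebra (F : fieldType) L of Vector F L := {
  lie : L -> L -> L;
  lie_linearl : forall y, linear (lie^~ y);
  lie_linearr : forall x, linear (lie x);
  liexx : forall x, lie x x = 0;
  lie_jacobi : forall x y z,
    lie x (lie y z) + lie y (lie z x) + lie z (lie x y) = 0
}.

(* Finite-dimensional Lie algebras over F: finite dimension comes from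
   vectType. *)
#[short(type="lieAlgType")]
HB.structure Definition LieAlgebra (F : fieldType) :=
  { L of Vector F L & Vector_isLieAlgebra F L }.

Section Subspaces.
Variables (F : fieldType) (L : lieAlgType F).
Implicit Types (U V W M I J S : {vspace L}) (u v x y z : L).

(* By bilinearity, spanning over bases gives the span of all brackets:
   see lie_prodvP. *)
Definition lie_prodv U V : {vspace L} :=
  <<[seq lie u v | u <- vbasis U, v <- vbasis V]>>%VS.

(* The notions below are relative to a subalgebra M of L, regarded as a Lie
   algebra of its own; L itself is {: L}. *)
Definition lie_subalgebra M : bool := (lie_prodv M M <= M)%VS.

Definition lie_ideal M I : bool := (I <= M)%VS && (lie_prodv M I <= I)%VS.

Definition lie_perfect I : bool := lie_prodv I I == I.

Definition lie_derived n U : {vspace L} := iter n (fun V => lie_prodv V V) U.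

Definition lie_lower_central n U : {vspace L} := iter n (lie_prodv U) U.

Definition lie_solvable U : Prop := exists n, lie_derived n U = 0%VS.

Definition lie_nilpotent U : Prop := exists n, lie_lower_central n U = 0%VS.

Definition lie_semisimple S : Prop :=
  forall I, lie_ideal S I -> lie_solvable I -> I = 0%VS.

Definition is_largest (Q : {vspace L} -> Prop) U : Prop :=
  Q U /\ forall V, Q V -> (V <= U)%VS.

(* The default value 0 is never used below: see perfect_radicalP, lie_radicalP
   and lie_nilradicalP. *)
Definition largest (Q : {vspace L} -> Prop) : {vspace L} :=
  xget 0%VS [set U | is_largest Q U]%classic.

Definition perfect_radical M : {vspace L} :=
  largest (fun I => lie_ideal M I /\ lie_perfect I).

Definition lie_radical M : {vspace L} :=
  largest (fun I => lie_ideal M I /\ lie_solvable I).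

Definition lie_nilradical M : {vspace L} :=
  largest (fun I => lie_ideal M I /\ lie_nilpotent I).

Definition levi_factor M S : Prop :=
  [/\ (S <= M)%VS, lie_subalgebra S, lie_semisimple S,
      (lie_radical M + S)%VS = M & (lie_radical M :&: S)%VS = 0%VS].

HB.instance Definition _ x :=
  GRing.isLinear.Build F L L *:%R (lie x) (lie_linearr x).

Lemma lieDl y : {morph lie^~ y : u v / u + v}.
Proof. by move=> u v; have := lie_linearl y 1 u v; rewrite !scale1r. Qed.

Lemma lieDr x : {morph lie x : u v / u + v}.
Proof. exact: raddfD. Qed.

Lemma lieZr x a u : lie x (a *: u) = a *: lie x u.
Proof. exact: linearZZ. Qed.

Lemma lieC x y : lie x y = - lie y x.
Proof.
apply/eqP; rewrite -addr_eq0; apply/eqP.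
by have := liexx (x + y); rewrite lieDl !lieDr !liexx add0r addr0.
Qed.

Lemma lie_leibniz x y z : lie x (lie y z) = lie (lie x y) z + lie y (lie x z).
Proof.
have /eqP := lie_jacobi x y z; rewrite -addrA addr_eq0 => /eqP->.
by rewrite (lieC z x) raddfN /= (lieC z) opprD !opprK addrC.
Qed.

Lemma mem_lie_prodv U V : {in U & V, forall u v, lie u v \in lie_prodv U V}.
Proof.
move=> u v /coord_vbasis-> /coord_vbasis->.
rewrite lieC memvN raddf_sum; apply: memv_suml => i _.
rewrite /= lieZr memvZ //= lieC memvN raddf_sum; apply: memv_suml => j _.
rewrite /= lieZr memvZ //= memv_span //.
by apply/allpairsP; exists ((vbasis U)`_i, (vbasis V)`_j); rewrite !memt_nth.
Qed.

Lemma lie_prodvP U V W :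
  reflect {in U & V, forall u v, lie u v \in W} (lie_prodv U V <= W)%VS.
Proof.
apply: (iffP idP) => [sUVW u v Uu Vv | sUVW].
  by rewrite (subvP sUVW) ?mem_lie_prodv.
apply/span_subvP=> _ /allpairsP[[u v] /= [Uu Vv ->]].
by rewrite sUVW ?vbasis_mem.
Qed.

Lemma lie_prodvS U1 U2 V1 V2 : (U1 <= U2)%VS -> (V1 <= V2)%VS ->
  (lie_prodv U1 V1 <= lie_prodv U2 V2)%VS.
Proof.
move=> /subvP sU /subvP sV; apply/lie_prodvP => u v /sU Uu /sV Vv.
exact: mem_lie_prodv.
Qed.

Lemma lie_prodvC U V : lie_prodv U V = lie_prodv V U.
Proof.
apply/eqP; rewrite eqEsubv; apply/andP; split; apply/lie_prodvP => u v Uu Vv;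
  by rewrite lieC memvN mem_lie_prodv.
Qed.

Lemma lie_prodvDr U V W :
  lie_prodv U (V + W) = (lie_prodv U V + lie_prodv U W)%VS.
Proof.
apply/eqP; rewrite eqEsubv; apply/andP; split; last first.
  by rewrite subv_add !lie_prodvS ?addvSl ?addvSr.
apply/lie_prodvP => u _ Uu /memv_addP[v Vv [w Ww ->]].
by rewrite lieDr memv_add ?mem_lie_prodv.
Qed.

Lemma lie_prodvDl U V W :
  lie_prodv (V + W) U = (lie_prodv V U + lie_prodv W U)%VS.
Proof. by rewrite !(lie_prodvC _ U) lie_prodvDr. Qed.

Lemma lie_ideal0 M : lie_ideal M 0%VS.
Proof.
rewrite /lie_ideal sub0v; apply/lie_prodvP => u v _.
by rewrite memv0 => /eqP->; rewrite raddf0 mem0v.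
Qed.

Lemma lie_idealD M I J : lie_ideal M I -> lie_ideal M J -> lie_ideal M (I + J).
Proof.
move=> /andP[sIM sMI] /andP[sJM sMJ].
rewrite /lie_ideal subv_add sIM sJM lie_prodvDr subv_add.
by rewrite (subv_trans sMI (addvSl _ _)) (subv_trans sMJ (addvSr _ _)).
Qed.

Lemma lie_ideal_prodv M I J :
  lie_ideal M I -> lie_ideal M J -> lie_ideal M (lie_prodv I J).
Proof.
move=> /andP[sIM /lie_prodvP sMI] /andP[sJM sMJ].
rewrite /lie_ideal (subv_trans (lie_prodvS sIM (subvv J))); last first.
  exact: subv_trans sMJ sJM.
move/lie_prodvP: sMJ => sMJ.
apply/lie_prodvP => x w Mx.
suff s: (lie_prodv I J <= linfun (lie x) @^-1: lie_prodv I J)%VS.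
  by move=> IJw; have := subvP s w IJw; rewrite -memv_preim lfunE.
apply/lie_prodvP => u v Iu Jv; rewrite -memv_preim lfunE /= lie_leibniz.
by rewrite memvD // mem_lie_prodv // ?sMI ?sMJ.
Qed.

Lemma lie_perfect0 : lie_perfect 0%VS.
Proof.
rewrite /lie_perfect -subv0; apply/lie_prodvP => u v _.
by rewrite memv0 => /eqP->; rewrite raddf0 mem0v.
Qed.

Lemma lie_perfectD M I J : lie_ideal M I -> lie_ideal M J ->
  lie_perfect I -> lie_perfect J -> lie_perfect (I + J).
Proof.
move=> iI iJ /eqP pI /eqP pJ; rewrite /lie_perfect eqEsubv.
have /andP[sM sMI] := lie_idealD iI iJ.
rewrite (subv_trans (lie_prodvS sM (subvv _)) sMI) /=.
by rewrite -{1}pI -{1}pJ subv_add !lie_prodvS ?addvSl ?addvSr.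
Qed.

Lemma lie_derivedS n U V :
  (U <= V)%VS -> (lie_derived n U <= lie_derived n V)%VS.
Proof. by elim: n => //= n IHn sUV; apply: lie_prodvS; apply: IHn. Qed.

Lemma lie_solvable0 : lie_solvable 0%VS.
Proof. by exists 0. Qed.

Lemma lie_solvableD M I J : lie_ideal M I -> lie_ideal M J ->
  lie_solvable I -> lie_solvable J -> lie_solvable (I + J).
Proof.
move=> /andP[sIM sMI] /andP[sJM sMJ] [n In0] [m Jm0]; exists (m + n)%N.
have sDM k : (lie_derived k I <= M)%VS.
  suff sDI : (lie_derived k I <= I)%VS by apply: subv_trans sDI sIM.
  elim: k => //= k IHk; apply: subv_trans sMI.
  by apply: lie_prodvS => //; apply: subv_trans sIM.
have s k : (lie_derived k (I + J) <= lie_derived k I + J)%VS.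
  elim: k => //= k IHk; apply: subv_trans (lie_prodvS IHk IHk) _.
  rewrite lie_prodvDl !lie_prodvDr.
  rewrite !subv_add addvSl /= (lie_prodvC J).
  have sJ V : (V <= M)%VS -> (lie_prodv V J <= lie_prodv (lie_derived k I)
                               (lie_derived k I) + J)%VS.
    move=> sVM; apply: subv_trans (addvSr _ _).
    exact: subv_trans (lie_prodvS sVM (subvv J)) sMJ.
  by rewrite !sJ.
apply/eqP; rewrite -subv0 -Jm0 /lie_derived iterD; apply: lie_derivedS.
by have := s n; rewrite In0 add0v.
Qed.

Lemma lie_nilpotent0 : lie_nilpotent 0%VS.
Proof. by exists 0. Qed.

Lemma lie_nilpotentD M I J : lie_subalgebra M -> lie_ideal M I ->
  lie_ideal M J -> lie_nilpotent I -> lie_nilpotent J -> lie_nilpotent (I + J).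
Proof.
move=> sMM iI iJ.
pose pow K n := iter n (lie_prodv K) M.
have ipow K n : lie_ideal M K -> lie_ideal M (pow K n).
  move=> iK; elim: n => [|n IHn] /=; first by rewrite /lie_ideal subvv.
  exact: lie_ideal_prodv.
have pow0 K : lie_ideal M K -> lie_nilpotent K ->
    exists n, forall m, (n <= m)%N -> pow K m = 0%VS.
  move=> /andP[sKM sMK] [n Kn0].
  have s k : (pow K k.+1 <= lie_lower_central k K)%VS.
    elim: k => [|k IHk] /=; first by rewrite lie_prodvC.
    exact: lie_prodvS.
  have K0 : pow K n.+1 = 0%VS by apply/eqP; rewrite -subv0 -Kn0 s.
  exists n.+1 => m /subnK <-; elim: (m - n.+1)%N => //= k ->.
  by case/andP: (lie_ideal0 K) => _; rewrite subv0 => /eqP.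
move=> /(pow0 _ iI)[n In0] /(pow0 _ iJ)[m Jm0]; exists (n + m)%N.
have [[sIM _] [sJM _]] := (andP iI, andP iJ).
pose T k := (\sum_(a < k.+1) (pow I a :&: pow J (k - a)%N))%VS.
suff s k : (lie_lower_central k (I + J) <= T k)%VS.
  apply/eqP; rewrite -subv0; apply: subv_trans (s _) _.
  apply/subv_sumP => a _; have [le_na | lt_an] := leqP n a.
    by rewrite In0 // cap0v.
  rewrite Jm0 ?capv0 //; rewrite leq_subRL ?(leq_trans (ltnW lt_an)) ?leq_addr//.
  by rewrite leq_add2r ltnW.
have sub_prod K a b K' : lie_ideal M K -> lie_ideal M K' ->
    (lie_prodv K (pow K a :&: pow K' b) <= pow K a.+1 :&: pow K' b)%VS.
  move=> /andP[sKM _] iK'; rewrite subv_cap /= lie_prodvS ?capvSl //=.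
  have /andP[_] := ipow _ b iK'; apply: subv_trans.
  by rewrite lie_prodvS ?capvSr.
elim: k => [|k IHk] /=.
  rewrite /T big_ord_recl big_ord0 addv0 /= capvv subv_add.
  by rewrite sIM sJM.
apply: subv_trans (lie_prodvS (subvv _) IHk) _.
apply/lie_prodvP => x y Ix /memv_sumP[u Tu ->].
rewrite raddf_sum; apply: memv_suml => a _ /=.
have {Tu} Tua := Tu a isT.
have /memv_addP[xi Ixi [xj Jxj ->]] := Ix; rewrite lieDl memvD //.
  have lt_a : (a.+1 < k.+2)%N by rewrite ltnS.
  apply: (subvP (sumv_sup (Ordinal lt_a) isT (subvv _))).
  by rewrite /= subSS (subvP (sub_prod _ _ _ _ iI iJ)) // mem_lie_prodv.
have lt_a : (a < k.+2)%N by rewrite ltnW // ltnS.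
apply: (subvP (sumv_sup (Ordinal lt_a) isT (subvv _))).
rewrite /= subSn; last by rewrite -ltnS.
rewrite capvC (subvP (sub_prod _ _ _ _ iJ iI)) // mem_lie_prodv //.
by rewrite capvC.
Qed.

Lemma largestP (Q : {vspace L} -> Prop) : Q 0%VS ->
  (forall U V, Q U -> Q V -> Q (U + V)%VS) -> is_largest Q (largest Q).
Proof.
move=> Q0 QD; apply: (@xgetPex _ 0%VS [set U | is_largest Q U]%classic).
pose d n := `[< exists2 U, Q U & \dim U = n >].
have ex_d : exists n, d n by exists 0; apply/asboolP; exists 0%VS; rewrite ?dimv0.
have ub_d n : d n -> (n <= \dim {: L})%N.
  by move=> /asboolP[U _ <-]; apply: dimvS (subvf U).
case: (ex_maxnP ex_d ub_d) => n /asboolP[U QU <-] max_U.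
exists U; split=> // V QV; have sU := addvSl U V.
suff -> : U = (U + V)%VS by apply: addvSr.
apply/eqP; rewrite eqEdim sU max_U //.
by apply/asboolP; exists (U + V)%VS => //; apply: QD.
Qed.

Lemma perfect_radicalP M :
  is_largest (fun I => lie_ideal M I /\ lie_perfect I) (perfect_radical M).
Proof.
apply: largestP => [|I J [iI pI] [iJ pJ]]; first by rewrite lie_ideal0 lie_perfect0.
by split; [exact: lie_idealD | exact: lie_perfectD iI iJ pI pJ].
Qed.

Lemma lie_radicalP M :
  is_largest (fun I => lie_ideal M I /\ lie_solvable I) (lie_radical M).
Proof.
apply: largestP => [|I J [iI sI] [iJ sJ]].
  by split; [exact: lie_ideal0 | exact: lie_solvable0].
by split; [exact: lie_idealD | exact: lie_solvableD iI iJ sI sJ].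
Qed.

Lemma lie_nilradicalP M : lie_subalgebra M ->
  is_largest (fun I => lie_ideal M I /\ lie_nilpotent I) (lie_nilradical M).
Proof.
move=> sM; apply: largestP => [|I J [iI nI] [iJ nJ]].
  by split; [exact: lie_ideal0 | exact: lie_nilpotent0].
by split; [exact: lie_idealD | exact: lie_nilpotentD sM iI iJ nI nJ].
Qed.

End Subspaces.

(* Main.v *)
From HB Require Import structures.
Require Import Defs.
From mathcomp Require Import all_boot all_order all_algebra.
From mathcomp Require Import boolp reals.
From mathcomp.real_closed Require Import complex.
From mathcomp Require Import ring.

(** Write R for the radical of L and P for its perfect radical. Everything
    formal follows from two facts of characteristic 0:
    - a semisimple Lie algebra S is perfect;
    - if R is a solvable ideal of M, then [M, R] is nilpotent.
    By the first fact a Levi factor S lies in every term of the derived series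
    of L; the last of these terms is a perfect ideal, so S lies in P. The
    modular law then gives P = (R /\ P) + S, and R(P) = R /\ P because R(P)
    meets S in a solvable ideal of S. Bracketing with P = [P, P] and again
    applying the modular law yields R(P) = [P, R(P)], which is nilpotent by
    the second fact.

    Both facts come out of one argument with traces
    [trace_form x y = tr (ad x ad y)], taken on all of L even when only a
    subalgebra M of L acts, so that no restriction of an operator to a subspace
    or a quotient is ever needed. The input from linear algebra is
    [exists_conj_semisimple_part]. For a complex matrix X with eigenvalues t_i
    let Y be the complex conjugate of its semisimple part. As conjugation is
    additive, [ad Y] is a polynomial in [ad X], divisible by any prescribed
    power of the variable, while tr (X Y) is the sum of the |t_i|^2. So X is
    nilpotent as soon as tr (X Y) = 0.

    Let I be an ideal of M and X = ad z with z in [M, I]. For u in M and v in I,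
    tr ([ad u, ad v] Y) = tr ([Y, ad u] ad v) is a combination of traces
    [trace_form (ad_z^k u) v] with k >= 3, and then ad_z^k u lies in
    [M, [I, I]]. Hence, if [M, [I, I]] is orthogonal to I, all elements of
    [M, I] are ad-nilpotent ([ad_nilpotent_of_trace_form]). By Engel's theorem
    [M, I] is then a nilpotent ideal, and it acts along a flag of M-stable
    subspaces, which makes it in turn orthogonal to M
    ([nilpotent_prodv_of_trace_form]). Since the conclusion for [I, I] is the
    hypothesis for I, this climbs up the derived series of a solvable ideal and
    proves the second fact. Applied to the kernel K of the trace form of a
    semisimple S it gives [S, K] = 0, so K is abelian and vanishes; if [S, S]
    were smaller than S, an element orthogonal to [S, S] would be central,
    which proves the first fact. *)

Set Implicit Arguments.
Unset Strict Implicit.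
Unset Printing Implicit Defensive.

Import GRing.Theory Num.Theory.
Local Open Scope ring_scope.

(** * Polynomials of an endomorphism *)

Section PolynomialsOfAnOperator.
Variables (K : fieldType) (V : lmodType K) (f : {linear V -> V}).

Implicit Types (p q : {poly K}) (w : V).

Definition peval (p : {poly K}) (w : V) : V :=
  \sum_(i < size p) p`_i *: iter i f w.

Lemma iter_linear (g : {linear V -> V}) k : linear (iter k g).
Proof.
by move=> a u v; elim: k => //= k ->; rewrite linearP.
Qed.

Lemma pevalE n p w : (size p <= n)%N ->
  peval p w = \sum_(i < n) p`_i *: iter i f w.
Proof.
move=> le_pn; rewrite /peval (big_ord_widen n (fun i => p`_i *: iter i f w)) //.
rewrite [RHS](bigID (fun i : 'I_n => (i < size p)%N)) /=.
rewrite [X in _ + X]big1 ?addr0 //.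
by move=> i; rewrite -leqNgt => /(nth_default 0)->; rewrite scale0r.
Qed.

Lemma pevalC c w : peval c%:P w = c *: w.
Proof. by rewrite (pevalE _ (size_polyC_leq1 c)) big_ord1 coefC. Qed.

Lemma pevalD p q w : peval (p + q) w = peval p w + peval q w.
Proof.
rewrite (pevalE w (leq_maxl (size p) (size q))).
rewrite (pevalE w (leq_maxr (size p) (size q))).
rewrite (pevalE w (size_polyD p q)) -big_split.
by apply: eq_bigr => i _; rewrite coefD scalerDl.
Qed.

Lemma peval_linear p : linear (peval p).
Proof.
move=> a u v; rewrite /peval scaler_sumr -big_split; apply: eq_bigr => i _.
by rewrite iter_linear scalerDr !scalerA mulrC.
Qed.

HB.instance Definition _ p :=
  GRing.isLinear.Build K V V *:%R (peval p) (peval_linear p).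

Lemma pevalM_XsubC p c w : peval (p * ('X - c%:P)) w = peval p (f w - c *: w).
Proof.
rewrite [X in peval p X]addrC -scaleNr peval_linear mulrBr pevalD.
rewrite addrC; congr (_ + _); last first.
  rewrite -mulrN -polyCN mulrC mul_polyC.
  rewrite (pevalE _ (size_scale_leq _ _)) scaler_sumr.
  by apply: eq_bigr => i _; rewrite coefZ scalerA.
rewrite (pevalE w (size_polyMleq p 'X)) size_polyX addn2 /= big_ord_recl.
rewrite coefMX eqxx scale0r add0r; apply: eq_bigr => i _.
by rewrite coefMX /= -iterSr.
Qed.

(** On a generalized eigenvector for [c], the operator [p f] depends only on
    [p] modulo a power of ['X - c]. *)
Lemma peval_eigen p c d m w : iter m (fun v => f v - c *: v) w = 0 ->
  ('X - c%:P) ^+ m %| p - d%:P -> peval p w = d *: w.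
Proof.
move=> w0 /dvdpP[q /eqP]; rewrite subr_eq => /eqP ->; rewrite pevalD pevalC.
suff -> : peval (q * ('X - c%:P) ^+ m) w = 0 by rewrite add0r.
elim: m w w0 => [|m IHm] w.
  by move=> /= ->; rewrite linear0.
by rewrite iterSr exprSr mulrA pevalM_XsubC => /IHm.
Qed.
End PolynomialsOfAnOperator.

(** * Interpolation modulo powers *)

Section Crt.
Variable K : fieldType.
Implicit Types (s : seq K) (m : nat).

Lemma coprimep_XsubC_prod a s m : a \notin s ->
  coprimep (('X - a%:P) ^+ m) (\prod_(b <- s) ('X - b%:P) ^+ m).
Proof.
move=> nas; apply: coprimep_expl.
elim: s nas => [_|b s IHs]; first by rewrite big_nil coprimep1.
rewrite inE negb_or big_cons coprimepMr => /andP[nab nas].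
by rewrite IHs // andbT coprimep_expr // coprimep_XsubC root_XsubC eq_sym.
Qed.

Lemma prod_XsubC_dvdp s m h : uniq s ->
  (forall a, a \in s -> ('X - a%:P) ^+ m %| h) ->
  \prod_(a <- s) ('X - a%:P) ^+ m %| h.
Proof.
elim: s => [_ _|a s IHs /= /andP[nas us] sh]; first by rewrite big_nil dvd1p.
rewrite big_cons Gauss_dvdp ?coprimep_XsubC_prod // sh ?mem_head //= IHs //.
by move=> b bs; rewrite sh // inE bs orbT.
Qed.

Lemma exists_interpolating_poly s m (f : K -> K) : uniq s ->
  exists q, forall a, a \in s -> ('X - a%:P) ^+ m %| q - (f a)%:P.
Proof.
elim: s => [_|a s IHs /= /andP[nas us]]; first by exists 0.
have [q sq] := IHs us.
have /Bezout_eq1_coprimepP[[u v] /= uv1] := coprimep_XsubC_prod m nas.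
set A := _ ^+ m in uv1; set B := \prod_(_ <- _) _ in uv1.
exists (q + ((f a)%:P - q) * (v * B)) => b; rewrite inE => /predU1P[-> | bs].
  have -> : q + ((f a)%:P - q) * (v * B) - (f a)%:P = (q - (f a)%:P) * u * A.
    by have -> : v * B = 1 - u * A; [rewrite -uv1 addrC addKr | ring].
  exact: dvdp_mull.
rewrite addrAC; apply: dvdp_add; first exact: sq.
by rewrite !dvdp_mull // /B (big_rem b) //= dvdp_mulIl.
Qed.
End Crt.

(** * Triangular matrices *)

Section Triangular.
Variables (K : fieldType) (n : nat).
Implicit Types (T U : 'M[K]_n.+1) (p : {poly K}).

Lemma mulmx_trig T U : is_trig_mx T -> is_trig_mx U ->
  is_trig_mx (T *m U) /\ forall i, (T *m U) i i = T i i * U i i.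
Proof.
move=> /is_trig_mxP trT /is_trig_mxP trU; split=> [|i].
  apply/is_trig_mxP => i j ltij; rewrite mxE big1 // => k _.
  have [ltik | leki] := ltnP i k; first by rewrite trT ?mul0r.
  by rewrite trU ?mulr0 // (leq_ltn_trans leki).
rewrite mxE (bigD1 i) //= big1 ?addr0 // => k nki.
have [ltik | leki] := ltnP i k; first by rewrite trT ?mul0r.
by rewrite trU ?mulr0 // ltn_neqAle nki.
Qed.

Lemma horner_mx_trig T p : is_trig_mx T ->
  is_trig_mx (horner_mx T p) /\ forall i, (horner_mx T p) i i = p.[T i i].
Proof.
move=> trT; elim/poly_ind: p => [|p c [trp diagp]].
  by rewrite rmorph0 mx0_is_trig; split=> // i; rewrite mxE horner0.
have [trpT diagpT] := mulmx_trig trp trT.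
rewrite rmorphD rmorphM /= horner_mx_X horner_mx_C; split=> [|i].
  apply/is_trig_mxP => i j ltij; rewrite mxE.
  rewrite (is_trig_mxP trpT) // add0r.
  by rewrite (is_trig_mxP (scalar_mx_is_trig _ _)).
by rewrite mxE diagpT diagp mxE eqxx hornerMXaddC mulr1n.
Qed.

Lemma nilpotent_strict_trig T : is_trig_mx T -> (forall i, T i i = 0) ->
  T ^+ n.+1 = 0.
Proof.
move=> trT T0; rewrite -(Cayley_Hamilton T) char_poly_trig //.
rewrite (eq_bigr (fun=> 'X)); last by move=> i _; rewrite T0 subr0.
by rewrite prodr_const card_ord rmorphXn /= horner_mx_X.
Qed.
End Triangular.

(** * The conjugate of the semisimple part of a matrix *)

Section ConjugateSemisimplePart.
Variables (C : numClosedFieldType).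

Lemma exists_trigonalization n (A : 'M[C]_n.+1) : exists P T,
  [/\ P \in unitmx, is_trig_mx T & A = invmx P *m T *m P].
Proof.
have [P /unitarymx_unit Pu trT] := Schur A (ltn0Sn n).
exists P, (conjmx P A); split=> //.
by rewrite conjumx // !mulmxA mulVmx // mul1mx mulmxKV.
Qed.

Lemma nilpotent_mxtrace n k (A : 'M[C]_n) : A ^+ k = 0 -> \tr A = 0.
Proof.
case: n A => [|n] A Ak0; first by rewrite [A]flatmx0 mxtrace0.
have [P [T [Pu trT defA]]] := exists_trigonalization A.
have defT : T = P *m A *m invmx P.
  by rewrite defA !mulmxA mulmxV // mul1mx mulmxK.
have Tk0 : horner_mx T 'X^k = 0.
  by rewrite defT horner_mx_uconj // rmorphXn /= horner_mx_X Ak0 mulmx0 mul0mx.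
rewrite defA -mulmxA mxtrace_mulC mulmxK // [\tr _]big1 // => i _.
have [_ /(_ i)] := horner_mx_trig 'X^k trT.
by rewrite Tk0 mxE hornerXn => /esym/eqP; rewrite expf_eq0 => /andP[_ /eqP].
Qed.

Lemma subrACA (V : zmodType) (a b c d : V) :
  (a - b) - (c - d) = (a - c) - (b - d).
Proof. by rewrite [- (c - d)]opprD addrACA -opprD. Qed.

Definition commutator n (x u : 'M[C]_n) : 'M[C]_n := x * u - u * x.

Lemma commutator_linear n (x : 'M[C]_n) : linear (commutator x).
Proof.
move=> a u v; rewrite /commutator -!mulmxE mulmxDr mulmxDl.
by rewrite -scalemxAr -scalemxAl scalerBr opprD addrACA.
Qed.

HB.instance Definition _ n (x : 'M[C]_n) :=
  GRing.isLinear.Build C 'M[C]_n 'M[C]_n *:%R (commutator x)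
    (commutator_linear x).

(** If [w] maps the generalized eigenspace of [x] for [b] into the one for [a]
    and kills the other ones, it is a generalized eigenvector of [ad x] for
    [a - b]: one application of [ad x - (a - b)] uses up a factor [x - a] on the
    left or a factor [x - b] on the right. *)
Lemma commutator_eigen n (x w : 'M[C]_n) a b i j :
  (x - a%:M) ^+ i * w = 0 -> w * (x - b%:M) ^+ j = 0 ->
  iter (i + j) (fun v => commutator x v - (a - b) *: v) w = 0.
Proof.
set g := fun v => _.
have gE v : g v = (x - a%:M) * v - v * (x - b%:M).
  rewrite /g /commutator mulrBl mulrBr -!mulmxE mul_scalar_mx mul_mx_scalar.
  by rewrite scalerBl [LHS]subrACA.
have gB k u v : iter k g (u - v) = iter k g u - iter k g v.
  by elim: k => //= k ->; rewrite /g linearB scalerBr [LHS]subrACA.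
have g0 k : iter k g 0 = 0 by have := gB k 0 0; rewrite !subrr.
have [m] := ubnP (i + j); elim: m i j w => // m IHm [|i] j w lem wi wj.
  by move: wi; rewrite expr0 mul1r => ->; rewrite g0.
case: j lem wj => [|j] lem wj.
  by move: wj; rewrite expr0 mulr1 => ->; rewrite g0.
rewrite addSn iterSr gE gB [X in X - _]IHm //.
- rewrite addnS -addSn IHm ?subrr //.
  + by rewrite addSn -addnS -ltnS.
  + by rewrite mulrA wi mul0r.
  + by rewrite -mulrA -exprS.
- by rewrite mulrA -exprSr.
- by rewrite -mulrA wj mulr0.
Qed.

(** The matrix [y] is the complex conjugate of the semisimple part of [x]: it is
    the scalar [conj a] on the generalized eigenspace of [x] for [a]. On a
    matrix [u] mapping the eigenspace for [b] into that for [a], both [ad y] and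
    [p (ad x)] are the scalar [conj a - conj b = conj (a - b)], once [p] takes
    the value [conj c] to high order at every difference [c] of eigenvalues.
    The difference [c = 0] is what lets [p] be divisible by ['X^N]. *)
Lemma exists_conj_semisimple_part n (x : 'M[C]_n) N : exists y p,
  [/\ 'X^N %| p, forall u, commutator y u = peval (commutator x) p u
    & \tr (x * y) = 0 -> x ^+ n = 0].
Proof.
case: n x => [|n] x.
  exists 0, 0; split=> [|u | _]; first exact: dvdp0.
    by rewrite [LHS]flatmx0 [RHS]flatmx0.
  by rewrite [LHS]flatmx0 [RHS]flatmx0.
have [P [T [Pu trT defx]]] := exists_trigonalization x.
have hornerx p : horner_mx x p = invmx P *m horner_mx T p *m P.
  by rewrite defx horner_mx_uconjC.
pose s := undup [seq T i i | i <- enum 'I_n.+1].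
have us : uniq s by apply: undup_uniq.
have sT i : T i i \in s.
  by rewrite mem_undup; apply/mapP; exists i; rewrite ?mem_enum.
pose m := n.+1.
have x_root h :
    (forall a, a \in s -> ('X - a%:P) ^+ m %| h) -> horner_mx x h = 0.
  move=> /(prod_XsubC_dvdp us); rewrite prodrXl => sh.
  have: char_poly T %| h.
    rewrite char_poly_trig //; apply: dvdp_trans sh.
    rewrite -[m]card_ord -prodr_const.
    apply: (big_ind2 (fun p1 p2 => p1 %| p2)) => [|*|i _]; first exact: dvdpp.
      exact: dvdp_mul.
    by rewrite (big_rem (T i i)) ?dvdp_mulIl // sT.
  case/dvdpP=> q ->; rewrite hornerx rmorphM /= Cayley_Hamilton mulr0.
  by rewrite mulmx0 mul0mx.
(* [horner_mx x (e a)] projects onto the generalized eigenspace for [a] *)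
have /boolp.choice[e e_delta] a : exists ea : {poly C}, forall b, b \in s ->
    ('X - b%:P) ^+ m %| ea - (b == a)%:R%:P.
  exact: (exists_interpolating_poly m (fun b => (b == a)%:R)).
have sum_e : \sum_(a <- s) horner_mx x (e a) = 1.
  apply/eqP; rewrite -subr_eq0 -(rmorph1 (horner_mx x)) -rmorph_sum -rmorphB /=.
  apply/eqP/x_root => b bs.
  have -> : 1 = \sum_(a <- s) (b == a)%:R%:P :> {poly C}.
    rewrite (big_rem b) //= eqxx big_seq big1 ?addr0 // => a.
    by rewrite mem_rem_uniq // inE eq_sym => /andP[/negPf->].
  rewrite -sumrB big_seq; elim/big_ind: _ => [||a _]; first exact: dvdp0.
    exact: dvdp_add.
  exact: e_delta.
have powE a : (x - a%:M) ^+ m = horner_mx x (('X - a%:P) ^+ m).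
  by rewrite rmorphXn rmorphB /= horner_mx_X horner_mx_C.
have eigen_e a : a \in s -> horner_mx x (e a) * (x - a%:M) ^+ m = 0.
  move=> sa; rewrite powE -rmorphM; apply: x_root => b bs.
  have [->|nba] := eqVneq b a; first exact: dvdp_mull.
  by have := e_delta a b bs; rewrite (negPf nba) subr0; apply: dvdp_mulr.
have [q q_conj] := exists_interpolating_poly m Num.conj us.
pose d := undup (0 :: [seq a - b | a <- s, b <- s]).
have ud : uniq d by apply: undup_uniq.
have [p p_conj] := exists_interpolating_poly (m + m + N) Num.conj ud.
have qE a : a \in s -> exists r,
    horner_mx x q = horner_mx x r * (x - a%:M) ^+ m + (a^*)%:M.
  move=> sa; have /dvdpP[r /eqP] := q_conj a sa; rewrite subr_eq => /eqP->.
  by exists r; rewrite rmorphD rmorphM /= horner_mx_C powE.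
exists (horner_mx x q), p; split=> [|u|].
- have := p_conj 0; rewrite /d mem_undup mem_head conjC0 !subr0 => /(_ isT).
  by apply: dvdp_trans; rewrite exprD dvdp_mull.
- pose w a b := horner_mx x (e a) * u * horner_mx x (e b).
  have -> : u = \sum_(a <- s) \sum_(b <- s) w a b.
    under eq_bigr do rewrite -mulr_sumr sum_e mulr1.
    by rewrite -mulr_suml sum_e mul1r.
  rewrite !linear_sum; apply: eq_big_seq => a sa.
  rewrite !linear_sum; apply: eq_big_seq => b sb /=.
  have wa : (x - a%:M) ^+ m * w a b = 0.
    by rewrite /w !mulrA powE comm_horner_mx2 -powE eigen_e ?mul0r.
  have wb : w a b * (x - b%:M) ^+ m = 0 by rewrite /w -!mulrA eigen_e ?mulr0.
  have dab : a - b \in d.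
    by rewrite mem_undup inE; apply/orP; right; apply/allpairsP; exists (a, b).
  rewrite (@peval_eigen _ _ _ p (a - b) (a - b)^* (m + m)); first last.
  + by apply: dvdp_trans (p_conj _ dab); rewrite dvdp_exp2l ?leq_addr.
  + exact: commutator_eigen.
  rewrite /commutator.
  have [r1 E1] := qE a sa; have [r2 E2] := qE b sb.
  have E2' : horner_mx x q = (x - b%:M) ^+ m * horner_mx x r2 + (b^*)%:M.
    by rewrite E2 powE comm_horner_mx2.
  rewrite {1}E1 E2' mulrDl mulrDr -mulrA wa mulr0 mulrA wb mul0r !add0r.
  by rewrite -!mulmxE mul_scalar_mx mul_mx_scalar -scalerBl rmorphB.
- have -> : x * horner_mx x q = horner_mx x ('X * q).
    by rewrite rmorphM /= horner_mx_X.
  rewrite hornerx -mulmxA mxtrace_mulC mulmxK //=.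
  have [_ diag] := horner_mx_trig ('X * q) trT.
  rewrite /mxtrace (eq_bigr (fun i => `|T i i| ^+ 2)) => [|i _]; last first.
    rewrite diag hornerM hornerX normCK; congr (_ * _).
    have /dvdpP[r /eqP]: ('X - (T i i)%:P) ^+ m %| q - ((T i i)^*)%:P.
      exact/q_conj/sT.
    rewrite subr_eq => /eqP->; rewrite hornerD hornerM horner_exp hornerXsubC.
    by rewrite subrr expr0n /= mulr0 add0r hornerC.
  move=> /eqP; rewrite psumr_eq0 => [|i _]; last by rewrite exprn_ge0.
  move=> /allP T0; have -> : x ^+ n.+1 = horner_mx x 'X^(n.+1).
    by rewrite rmorphXn /= horner_mx_X.
  rewrite hornerx rmorphXn /= horner_mx_X.
  rewrite nilpotent_strict_trig ?mulmx0 ?mul0mx //.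
  move=> i; have := T0 i (mem_index_enum i).
  by rewrite expf_eq0 /= normr_eq0 => /eqP.
Qed.
End ConjugateSemisimplePart.

(** * Traces of operators on a vector space *)

Section OperatorMatrix.
Variables (F : fieldType) (V : vectType F).
Implicit Types f g : {linear V -> V}.

Let b := vbasis {:V}.

Definition op_mx (f : V -> V) : 'M[F]_(\dim {:V}) :=
  \matrix_(i, j) coord b i (f b`_j).

Lemma op_mx_comp f (g : V -> V) : op_mx (f \o g) = op_mx f * op_mx g.
Proof.
apply/matrixP => i j; rewrite !mxE /= {1}(coord_vbasis (memvf (g b`_j))).
rewrite !linear_sum; apply: eq_bigr => k _.
by rewrite !mxE mulrC !linearZ.
Qed.

Lemma op_mx_eq0 f : op_mx f = 0 -> forall v, f v = 0.
Proof.
move=> f0 v; rewrite (coord_vbasis (memvf v)) linear_sum big1 // => j _.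
rewrite linearZ /= [f _](coord_vbasis (memvf _)) big1 ?scaler0 // => i _.
by have /matrixP/(_ i j) := f0; rewrite !mxE => ->; rewrite scale0r.
Qed.

Lemma op_mx_iter f k : op_mx (iter k f) = op_mx f ^+ k.
Proof.
elim: k => [|k IHk]; last by rewrite exprS -IHk -op_mx_comp.
apply/matrixP => i j; rewrite expr0 !mxE.
by rewrite coord_free ?(basis_free (vbasisP _)) // eq_sym.
Qed.

Lemma op_mx_nilpotent f k : op_mx f ^+ k = 0 <-> forall v, iter k f v = 0.
Proof.
rewrite -op_mx_iter; split=> [|fk0]; last first.
  by apply/matrixP => i j; rewrite !mxE fk0 linear0.
pose g := HB.pack_for {linear V -> V} (iter k f)
  (GRing.isLinear.Build _ _ _ _ _ (iter_linear f k)).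
exact: (@op_mx_eq0 g).
Qed.
End OperatorMatrix.

Section Subspaces.
Variables (F : fieldType) (V : vectType F).

Lemma exists_maximal_vspace (Q : {vspace V} -> Prop) U0 : Q U0 ->
  exists2 U, Q U & forall W, Q W -> (U <= W)%VS -> W = U.
Proof.
move=> Q0; pose d n := `[< exists2 U, Q U & \dim U = n >].
have ex_d : exists n, d n by exists (\dim U0); apply/asboolP; exists U0.
have ub_d n : d n -> (n <= \dim {:V})%N.
  by move=> /asboolP[U _ <-]; apply: dimvS (subvf U).
have [n /asboolP[U QU <-] max_U] := ex_maxnP ex_d ub_d.
exists U => // W QW sUW; apply/esym/eqP; rewrite eqEdim sUW max_U //.
by apply/asboolP; exists W.
Qed.

Lemma exists_vspace_of_pred (Q : V -> Prop) : Q 0 ->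
  (forall a u v, Q u -> Q v -> Q (a *: u + v)) ->
  exists U : {vspace V}, forall v, v \in U <-> Q v.
Proof.
move=> Q0 Qlin; pose QU (U : {vspace V}) := forall v, v \in U -> Q v.
have QU0 : QU 0%VS by move=> v; rewrite memv0 => /eqP->.
have [U QUU maxU] := exists_maximal_vspace QU0.
exists U => v; split=> [|Qv]; first exact: QUU.
suff <- : (U + <[v]>)%VS = U by rewrite (subvP (addvSr _ _)) ?memv_line.
apply: maxU (addvSl _ _) => _ /memv_addP[u Uu [_ /vlineP[a ->] ->]].
by rewrite addrC; apply: Qlin => //; apply: QUU.
Qed.
End Subspaces.

(** * The trace form and Cartan's criterion *)

Section TraceForm.
Variables (F : fieldType) (C : numClosedFieldType) (iota : {rmorphism F -> C}).
Variable (L : lieAlgType F).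
Implicit Types (x y z u v w : L) (A B I M N R S U W : {vspace L}).

Definition ad_mx x : 'M[F]_(\dim {:L}) := op_mx (lie x).

Definition ad_nilpotent x : Prop := exists k, forall v, iter k (lie x) v = 0.

Definition trace_form x y : F := \tr (ad_mx x * ad_mx y).

Lemma lieZl a x y : lie (a *: x) y = a *: lie x y.
Proof. by rewrite lieC lieZr -scalerN -lieC. Qed.

Lemma ad_mx_linear : linear ad_mx.
Proof.
move=> a x y; apply/matrixP => i j; rewrite !mxE.
by rewrite lie_linearl linearP.
Qed.

HB.instance Definition _ := GRing.isLinear.Build F L _ *:%R ad_mx ad_mx_linear.

Lemma ad_mx_lie x y : ad_mx (lie x y) = ad_mx x * ad_mx y - ad_mx y * ad_mx x.
Proof.
rewrite /ad_mx -!op_mx_comp; apply/matrixP => i j; rewrite !mxE -linearB /=.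
by rewrite lie_leibniz addrK.
Qed.

Lemma trace_formC x y : trace_form x y = trace_form y x.
Proof. exact: mxtrace_mulC. Qed.

Lemma trace_form_linear x : scalar (trace_form x).
Proof.
move=> a u v; rewrite /trace_form linearP -mulmxE mulmxDr -scalemxAr.
by rewrite mxtraceD mxtraceZ.
Qed.

HB.instance Definition _ x :=
  GRing.isLinear.Build F L F *%R (trace_form x) (trace_form_linear x).

Lemma trace_form_lie x y z : trace_form (lie x y) z = trace_form x (lie y z).
Proof.
rewrite /trace_form !ad_mx_lie mulrBl mulrBr !mulrA !linearB /=.
by congr (_ - _); rewrite -[X in \tr X = _]mulrA [LHS]mxtrace_mulC.
Qed.

Lemma lie_prodv_ind (Q : L -> Prop) U W : Q 0 ->
    (forall a u v, Q u -> Q v -> Q (a *: u + v)) ->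
    {in U & W, forall u w, Q (lie u w)} ->
  forall z, z \in lie_prodv U W -> Q z.
Proof.
move=> Q0 Qlin Qlie z; have [X XE] := exists_vspace_of_pred Q0 Qlin.
move=> zUW; apply/XE; apply: subvP zUW.
by apply/lie_prodvP => u w Uu Ww; apply/XE/Qlie.
Qed.

Lemma iter_commutator_ad z k u :
  iter k (commutator (map_mx iota (ad_mx z))) (map_mx iota (ad_mx u)) =
  map_mx iota (ad_mx (iter k (lie z) u)).
Proof.
elim: k => //= k ->; rewrite ad_mx_lie /commutator.
by rewrite map_mxB -!mulmxE !map_mxM.
Qed.

(** This is Cartan's criterion in the generality that serves both for solvable
    ideals and for the kernel of the trace form. With [Y] the conjugate of the
    semisimple part of [ad z], the invariance of the trace turns tr ([u, v] Y)
    into traces of (ad_z^k u) v, and those with [k < 3] are absent. *)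
Lemma ad_nilpotent_of_trace_form M I : lie_ideal M I ->
    {in lie_prodv M (lie_prodv I I) & I, forall w v, trace_form w v = 0} ->
  {in lie_prodv M I, forall z, ad_nilpotent z}.
Proof.
move=> /andP[sIM sMI] orth z zMI.
pose X := map_mx iota (ad_mx z).
have [Y [p [Xp comYp nilX]]] := exists_conj_semisimple_part X 3.
exists (\dim {:L}); apply/op_mx_nilpotent.
apply: (map_mx_inj (f := iota)); rewrite map_mx0 -/(ad_mx z) rmorphXn /=.
apply: nilX.
(* [z] lies in [I]: the first bracket lands in [I], the second in [I, I] *)
have depth3 u k : u \in M ->
    iter k.+3 (lie z) u \in lie_prodv M (lie_prodv I I).
  have Iz : z \in I by apply: subvP zMI.
  move=> Mu; have Ik j : iter j.+1 (lie z) u \in I.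
    elim: j => [|j IHj].
      by rewrite /= lieC memvN (subvP sMI) ?mem_lie_prodv.
    by rewrite iterS (subvP sMI) // mem_lie_prodv // (subvP sIM).
  by rewrite iterS mem_lie_prodv ?(subvP sIM _ Iz) // iterS mem_lie_prodv.
(* [Y] is kept fixed while [z] runs over [M, I] *)
pose Q t := \tr (map_mx iota (ad_mx t) * Y) = 0.
apply: (lie_prodv_ind (Q := Q)) zMI => [|a u v Qu Qv|u v Mu Iv]; rewrite /Q.
- by rewrite linear0 map_mx0 mul0r mxtrace0.
- rewrite linearP map_mxD map_mxZ mulrDl -mulmxE -scalemxAl mxtraceD mxtraceZ.
  by rewrite !mulmxE Qu Qv mulr0 addr0.
set U := map_mx iota (ad_mx u); set W := map_mx iota (ad_mx v).
have -> : \tr (map_mx iota (ad_mx (lie u v)) * Y) = \tr (commutator Y U * W).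
  rewrite ad_mx_lie map_mxB -!mulmxE !map_mxM -/U -/W /commutator -!mulmxE.
  rewrite !mulmxBl !linearB /= mxtrace_mulC mulmxA.
  by rewrite -[in X in _ - X]mulmxA [X in _ - X]mxtrace_mulC.
have p0 k : (k < 3)%N -> p`_k = 0.
  by move=> ltk3; have /dvdpP[q ->] := Xp; rewrite coefMXn ltk3.
rewrite comYp /peval mulr_suml linear_sum big1 //= => i _.
have [|le3i] := ltnP i 3.
  by move=> /p0->; rewrite scale0r mul0r mxtrace0.
rewrite -mulmxE -scalemxAl mxtraceZ iter_commutator_ad mulmxE.
rewrite -(subnK le3i) addn3.
rewrite -rmorphM /= trace_map_mx.
by rewrite [\tr _](orth _ v (depth3 _ _ Mu) Iv) rmorph0 mulr0.
Qed.

(** * Engel's theorem *)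

(** Quotients are avoided by acting on a pair of stable subspaces [A] and [B]
    and looking for a vector of [B] that is killed modulo [A]. Let [N] be a
    maximal proper subalgebra of [M]. The statement for [N] acting on the pair
    of [N] and [M] yields [x] normalizing [N], so [M = N + <[x]>] by maximality;
    the vectors of [B] killed by [N] modulo [A] form an [x]-stable subspace, on
    which [x] is nilpotent. *)
Lemma engel_step n M A B : (\dim M < n)%N -> lie_subalgebra M ->
    {in M, forall x, ad_nilpotent x} -> (A <= B)%VS -> ~~ (B <= A)%VS ->
    (lie_prodv M A <= A)%VS -> (lie_prodv M B <= B)%VS ->
  exists b, [/\ b \in B, b \notin A & {in M, forall m, lie m b \in A}].
Proof.
elim: n M A B => // n IHn M A B ltMn algM nilM sAB nsBA sMA sMB.
have [M0 | nzM] := eqVneq M 0%VS.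
  have [b Bb nAb] := subvPn nsBA; exists b; split=> // m.
  by rewrite M0 memv0 lieC => /eqP->; rewrite linear0 oppr0 mem0v.
pose Q U := [/\ lie_subalgebra U, (U <= M)%VS & U != M].
have Q0 : Q 0%VS.
  split; rewrite ?sub0v 1?eq_sym //.
  by case/andP: (lie_ideal0 (0%VS : {vspace L})).
have [N [algN sNM neqNM] maxN] := exists_maximal_vspace Q0.
have ltNM : (\dim N < \dim M)%N.
  by rewrite ltnNge; apply: contra neqNM => leMN; rewrite eqEdim sNM.
have nilN : {in N, forall x, ad_nilpotent x} by move=> x /(subvP sNM)/nilM.
have /lie_prodvP memMA := sMA.
have /lie_prodvP memMB := sMB.
have [||||x [Mx nNx NxN]] := IHn N N M _ algN nilN sNM.
- exact: leq_trans ltNM _.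
- by apply: contra neqNM => sMN; rewrite eqEsubv sNM.
- exact: algN.
- exact: subv_trans (lie_prodvS sNM (subvv M)) algM.
have defM : (N + <[x]>)%VS = M.
  apply/eqP; apply: contraNT nNx => neqM.
  suff <- : (N + <[x]>)%VS = N by rewrite (subvP (addvSr _ _)) ?memv_line.
  apply: maxN (addvSl _ _); split=> //; last by rewrite subv_add sNM -memvE.
  apply/lie_prodvP => _ _ /memv_addP[u Nu [_ /vlineP[a ->] ->]]
    /memv_addP[v Nv [_ /vlineP[c ->] ->]].
  apply: (subvP (addvSl _ _)); rewrite lieDl !lieDr !lieZr memvD //.
    by rewrite memvD ?memvZ ?NxN ?(lie_prodvP _ _ _ algN).
  by rewrite !lieZl liexx !scaler0 addr0 memvZ // lieC memvN NxN.
have [B' B'E] : exists B' : {vspace L}, forall v, v \in B' <->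
    v \in B /\ {in N, forall u, lie u v \in A}.
  apply: exists_vspace_of_pred => [|a u v [Bu NuA] [Bv NvA]].
    by split=> [|w _]; rewrite ?linear0 mem0v.
  split=> [|w Nw]; first by rewrite memvD ?memvZ.
  by rewrite lieDr lieZr memvD ?memvZ ?NuA ?NvA.
have [|||b [Bb nAb NbA]] := IHn N A B _ algN nilN sAB nsBA.
- exact: leq_trans ltNM _.
- exact: subv_trans (lie_prodvS sNM (subvv A)) sMA.
- exact: subv_trans (lie_prodvS sNM (subvv B)) sMB.
have xB' v : v \in B' -> lie x v \in B'.
  move=> /B'E[Bv NvA]; apply/B'E; split=> [|u Nu]; first exact: memMB.
  rewrite lie_leibniz memvD //; last by rewrite memMA ?NvA.
  by rewrite NvA ?NxN.
have B'k k : iter k (lie x) b \in B'.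
  by elim: k => [|k IHk] /=; [apply/B'E | apply: xB'].
(* the last power of [ad x] that leaves [b] outside [A] gives the vector *)
have exk : exists k, iter k (lie x) b \in A.
  by have [k xk0] := nilM x Mx; exists k; rewrite xk0 mem0v.
have [[|k] Ak mink] := ex_minnP exk; first by rewrite /= (negPf nAb) in Ak.
have /B'E[Bk NkA] := B'k k.
exists (iter k (lie x) b); split=> // [|m].
  by apply: contraL (ltnSn k) => /mink; rewrite -leqNgt.
rewrite -defM => /memv_addP[u Nu [_ /vlineP[a ->] ->]].
by rewrite lieDl lieZl memvD ?NkA ?memvZ.
Qed.

Lemma engel N : lie_subalgebra N -> {in N, forall x, ad_nilpotent x} ->
  exists n, iter n (lie_prodv N) fullv = 0%VS.
Proof.
move=> algN nilN.
pose Q W := (lie_prodv N W <= W)%VS /\ exists n, iter n (lie_prodv N) W = 0%VS.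
have Q0 : Q 0%VS by split; [case/andP: (lie_ideal0 N) | exists 0].
have [W [sNW [n Wn0]] maxW] := exists_maximal_vspace Q0.
have [sfW | nsfW] := boolP (fullv <= W)%VS.
  by exists n; rewrite (_ : fullv = W) //; apply/eqP; rewrite eqEsubv sfW subvf.
have [b [_ nWb NbW]] :=
  engel_step (ltnSn _) algN nilN (subvf W) nsfW sNW (subvf _).
case/negP: nWb; suff <- : (W + <[b]>)%VS = W.
  by rewrite (subvP (addvSr _ _)) ?memv_line.
have sNWb : (lie_prodv N (W + <[b]>) <= W)%VS.
  rewrite lie_prodvDr subv_add sNW; apply/lie_prodvP => u _ Nu /vlineP[a ->].
  by rewrite lieZr memvZ ?NbW.
apply: maxW (addvSl _ _); split; first exact: subv_trans sNWb (addvSl _ _).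
exists n.+1; apply/eqP; rewrite -subv0 -Wn0 iterSr.
by elim: n {Wn0} => //= n IHn; apply: lie_prodvS.
Qed.

(** The subspaces [D k] of [L] spanned by brackets with [k] factors in [N] are
    stable under the whole of [M], so [ad z \o ad y] goes down this flag for [z]
    in [N] and [y] in [M], and has trace 0. *)
Lemma trace_form_nil_ideal M N : lie_subalgebra M -> lie_ideal M N ->
    {in N, forall x, ad_nilpotent x} ->
  lie_nilpotent N /\ {in N & M, forall z y, trace_form z y = 0}.
Proof.
move=> algM /andP[sNM sMN] nilN.
have algN : lie_subalgebra N.
  exact: subv_trans (lie_prodvS sNM (subvv N)) sMN.
have [n Dn0] := engel algN nilN; pose D k := iter k (lie_prodv N) fullv.
split=> [|z y Nz My].
  exists n; apply/eqP; rewrite -subv0 -Dn0.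
  by elim: n {Dn0} => [|n IHn] /=; rewrite ?subvf ?lie_prodvS.
have MD k : {in M & D k, forall m v, lie m v \in D k}.
  elim: k => [|k IHk] m v Mm Dv; first exact: memvf.
  pose Q v := lie m v \in D k.+1; rewrite -/(Q v).
  apply: (lie_prodv_ind (Q := Q)) Dv => [|a u w|u w Nu Dw]; rewrite /Q.
  - by rewrite linear0 mem0v.
  - by move=> Du Dw; rewrite linearP memvD ?memvZ.
  - rewrite lie_leibniz memvD ?mem_lie_prodv //; last exact: IHk.
    by rewrite (subvP sMN) ?mem_lie_prodv.
rewrite /trace_form -op_mx_comp.
suff nil : op_mx (lie z \o lie y) ^+ n = 0.
  have := @nilpotent_mxtrace C _ n (map_mx iota (op_mx (lie z \o lie y))).
  rewrite -rmorphXn /= nil map_mx0 trace_map_mx => /(_ erefl) /eqP.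
  by rewrite fmorph_eq0 => /eqP.
apply/(op_mx_nilpotent (lie z \o lie y)) => v; apply/eqP; rewrite -memv0 -Dn0.
elim: n {Dn0} => [|n IHn]; first exact: memvf.
by rewrite iterS /= mem_lie_prodv // MD.
Qed.

(** The conclusion for an ideal [I] of [M] supplies the hypothesis for an ideal
    [J] such that [J, J] = I, so that the lemma can be iterated. *)
Lemma nilpotent_prodv_of_trace_form M I : lie_subalgebra M -> lie_ideal M I ->
    {in lie_prodv M (lie_prodv I I) & I, forall w v, trace_form w v = 0} ->
  lie_nilpotent (lie_prodv M I) /\
  {in lie_prodv M I & M, forall z y, trace_form z y = 0}.
Proof.
move=> algM idI orth; apply: trace_form_nil_ideal => //.
  by apply: lie_ideal_prodv => //; rewrite /lie_ideal subvv.
exact: ad_nilpotent_of_trace_form.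
Qed.

(** * Solvable ideals and semisimple subalgebras *)

Lemma lie_ideal_refl M : lie_subalgebra M -> lie_ideal M M.
Proof. by rewrite /lie_ideal subvv. Qed.

Lemma lie_nilpotent_prodv_solvable M R : lie_subalgebra M -> lie_ideal M R ->
  lie_solvable R -> lie_nilpotent (lie_prodv M R).
Proof.
move=> algM idR [n Rn0].
(* orthogonality to [M] is what the induction on the derived length passes on *)
suff [] : lie_nilpotent (lie_prodv M R) /\
  {in lie_prodv M R & M, forall z y, trace_form z y = 0} by [].
elim: n R idR Rn0 => [|n IHn] R idR.
  move=> /= R0; apply: nilpotent_prodv_of_trace_form => // w v _.
  by rewrite R0 memv0 => /eqP->; rewrite linear0.
rewrite /lie_derived iterSr => /(IHn _ (lie_ideal_prodv idR idR))[_ orth].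
apply: nilpotent_prodv_of_trace_form => // w v Mw Rv; apply: orth => //.
by case/andP: idR => /subvP->.
Qed.

Lemma lie_nilpotent_solvable N :
  lie_subalgebra N -> lie_nilpotent N -> lie_solvable N.
Proof.
move=> algN [n Nn0]; exists n; apply/eqP; rewrite -subv0 -Nn0.
have sD k : (lie_derived k N <= N)%VS.
  by elim: k => //= k IHk; apply: subv_trans algN; apply: lie_prodvS.
elim: n {Nn0} => //= n IHn; exact: lie_prodvS.
Qed.

(** Let [K] be the kernel of the trace form of [S]: [S, K] is a nilpotent ideal,
    hence 0, so [K] is an abelian ideal, hence 0. If [S, S] had smaller dimension
    than [S], some nonzero element of [S] would be orthogonal to [S, S]; by
    invariance its brackets with [S] lie in [K], so it would span a central
    ideal. *)
Lemma semisimple_perfect S :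
  lie_subalgebra S -> lie_semisimple S -> lie_perfect S.
Proof.
move=> algS ssS; have idS := lie_ideal_refl algS.
have abelian0 I : lie_ideal S I -> lie_prodv I I = 0%VS -> I = 0%VS.
  by move=> idI II0; apply: ssS => //; exists 1.
have [K KE] : exists K : {vspace L}, forall x, x \in K <->
    x \in S /\ {in S, forall y, trace_form y x = 0}.
  apply: exists_vspace_of_pred => [|a u v [Su uS] [Sv vS]].
    by split=> [|y _]; rewrite ?linear0 ?mem0v.
  split=> [|y Sy]; first by rewrite memvD ?memvZ.
  by rewrite linearP /= uS // vS // mulr0 addr0.
have idK : lie_ideal S K.
  apply/andP; split; first by apply/subvP => x /KE[].
  apply/lie_prodvP => u x Su /KE[Sx xS]; apply/KE.
  have Sux := lie_prodvP _ _ _ algS.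
  by split=> [|y Sy]; [apply: Sux | rewrite -trace_form_lie xS ?Sux].
have [sKS sSK] := andP idK.
have SK0 : lie_prodv S K = 0%VS.
  have idSK := lie_ideal_prodv idS idK.
  apply: ssS => //; apply: lie_nilpotent_solvable.
    have [sSKS sSSK] := andP idSK.
    exact: subv_trans (lie_prodvS sSKS (subvv _)) sSSK.
  apply: (nilpotent_prodv_of_trace_form algS idK _).1 => w v SKw /KE[_ ->] //.
  have sKKS : (lie_prodv K K <= S)%VS.
    by apply: subv_trans algS; apply: lie_prodvS.
  by rewrite (subvP algS) // (subvP (lie_prodvS (subvv S) sKKS)).
have K0 : K = 0%VS.
  by apply: abelian0 => //; apply/eqP; rewrite -subv0 -SK0 lie_prodvS.
rewrite /lie_perfect eqEsubv; apply/andP; split; first exact: algS.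
apply: contraT => nsSS.
pose b := vbasis (lie_prodv S S).
have ltSS : (\dim (lie_prodv S S) < \dim S)%N.
  rewrite ltnNge; apply: contra nsSS => leS.
  have /eqP eqS : lie_prodv S S == S by rewrite eqEdim leS andbT; exact: algS.
  by rewrite {1}eqS.
pose rV := 'rV[F]_(\dim (lie_prodv S S)).
pose pairing x : rV := \row_i trace_form b`_i x.
have pairing_linear : linear pairing.
  by move=> a u v; apply/rowP => i; rewrite !mxE linearP.
pose phi := linfun (HB.pack_for {linear L -> rV} pairing
  (GRing.isLinear.Build _ _ _ _ _ pairing_linear)).
have : (0 < \dim (S :&: lker phi))%N.
  rewrite -(ltn_add2r (\dim (phi @: S))) limg_ker_dim add0n.
  apply: leq_ltn_trans ltSS; apply: leq_trans (dimvS (subvf _)) _.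
  by rewrite dimvf /= /dim /= mul1n.
rewrite lt0n dimv_eq0 => /negP[].
set Z := (_ :&: _)%VS; rewrite -subv0 -K0.
have sZK : (lie_prodv S Z <= K)%VS.
  apply/lie_prodvP => y x Sy; rewrite memv_cap => /andP[Sx].
  rewrite memv_ker lfunE /= => /eqP phix0; apply/KE.
  have memSS := lie_prodvP _ _ _ algS.
  split=> [|s Ss]; first exact: memSS.
  rewrite -trace_form_lie (coord_vbasis (mem_lie_prodv Ss Sy)).
  rewrite trace_formC linear_sum big1 // => i _ /=.
  rewrite linearZ /= trace_formC; have /rowP/(_ i) := phix0.
  by rewrite !mxE => ->; rewrite mulr0.
have idZ : lie_ideal S Z.
  by rewrite /lie_ideal capvSl (subv_trans sZK) // K0 sub0v.
rewrite K0 subv0; apply/eqP/abelian0 => //; apply/eqP; rewrite -subv0 -K0.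
by apply: subv_trans sZK; rewrite lie_prodvS ?capvSl.
Qed.
End TraceForm.

(** * The perfect radical *)

Section PerfectRadical.
Variables (F : fieldType) (L : lieAlgType F).
Implicit Types (M P R S I J : {vspace L}).

(** The derived series of [M] stabilizes at a perfect ideal, and all its terms
    contain [S] because [S] is perfect. *)
Lemma lie_perfect_sub_radical M S : lie_subalgebra M -> (S <= M)%VS ->
  lie_perfect S -> (S <= perfect_radical M)%VS.
Proof.
move=> algM sSM /eqP pS; pose D k := lie_derived k M.
have idD k : lie_ideal M (D k).
  by elim: k => [|k IHk]; [exact: lie_ideal_refl | exact: lie_ideal_prodv].
have sSD k : (S <= D k)%VS.
  by elim: k => //= k IHk; rewrite -pS; apply: lie_prodvS.
have sDS k : (D k.+1 <= D k)%VS.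
  have [sDM] := andP (idD k); apply: subv_trans.
  exact: lie_prodvS.
(* otherwise every step loses a dimension *)
have [n pD] : exists n, D n.+1 = D n.
  apply: contrapT => neqD.
  have ltD k : (\dim (D k) + k <= \dim M)%N.
    elim: k => [|k IHk]; first by rewrite addn0.
    apply: leq_trans IHk; rewrite addnS -addSn leq_add2r ltnNge.
    by apply/negP => le; apply: neqD; exists k; apply/eqP; rewrite eqEdim sDS.
  by have := ltD (\dim M).+1; rewrite addnS ltnNge leq_addl.
have [_ maxP] := perfect_radicalP M.
by apply: subv_trans (sSD n) (maxP _ _); split; last exact/eqP.
Qed.

Lemma lie_derived_sub n M I : (I <= M)%VS -> lie_derived n M = 0%VS ->
  lie_derived n I = 0%VS.
Proof. by move=> sIM Mn0; apply/eqP; rewrite -subv0 -Mn0 lie_derivedS. Qed.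

(** The modular law splits [P] as [R :&: P + S] for the radical [R] of [M]. The
    radical of [P] contains [R :&: P] and meets [S] in a solvable ideal of [S],
    that is, in 0; by the modular law again it is [R :&: P]. *)
Lemma levi_factor_cap M P S : lie_ideal M P ->
    levi_factor M S -> (S <= P)%VS ->
  levi_factor P S /\ lie_radical P = (lie_radical M :&: P)%VS.
Proof.
move=> /andP[sPM sMP] [sSM algS ssS defM trivRS] sSP.
have [[/andP[sRM sMR] [n Rn0]] _] := lie_radicalP M.
set R := lie_radical M in sRM sMR Rn0 defM trivRS *.
have [[/andP[sTP sPT] solT] maxT] := lie_radicalP P.
set T := lie_radical P in sTP sPT solT maxT *.
have idRP : lie_ideal P (R :&: P).
  rewrite /lie_ideal capvSr subv_cap.
  rewrite (subv_trans _ sMR) ?lie_prodvS ?capvSl //=.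
  by rewrite (subv_trans _ sMP) ?lie_prodvS ?capvSr.
have solRP : lie_solvable (R :&: P).
  by exists n; apply: lie_derived_sub Rn0; apply: capvSl.
have sRPT : (R :&: P <= T)%VS by apply: maxT.
have defP : (R :&: P + S)%VS = P.
  by rewrite (capvC R) vspace_modr // defM; apply/capv_idPl.
have TS0 : (T :&: S)%VS = 0%VS.
  have [m Tm0] := solT; apply: ssS; last first.
    by exists m; apply: lie_derived_sub Tm0; apply: capvSl.
  rewrite /lie_ideal capvSr subv_cap.
  rewrite (subv_trans _ sPT) ?lie_prodvS ?capvSl //=.
  by rewrite (subv_trans _ algS) ?lie_prodvS ?capvSr.
have defT : T = (R :&: P)%VS.
  rewrite -[LHS](capv_idPr sTP) -[X in (X :&: _)%VS]defP -vspace_modl //.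
  by rewrite (capvC S) TS0 addv0.
by split=> //; split=> //; rewrite -/T defT.
Qed.
End PerfectRadical.

(** All that is used of the scalars is that they embed into a field with
    eigenvalues and a complex conjugation. *)
Lemma levi_factor_perfect_radical (F : fieldType) (C : numClosedFieldType)
    (iota : {rmorphism F -> C}) (L : lieAlgType F) M (S : {vspace L}) :
  lie_subalgebra M -> levi_factor M S ->
  let P := perfect_radical M in
  [/\ (S <= P)%VS, levi_factor P S
    & [/\ lie_radical P = (lie_radical M :&: P)%VS,
          (lie_radical M :&: P <= lie_nilradical P)%VS,
          lie_radical P = lie_nilradical P
        & lie_nilpotent (lie_radical P)]].
Proof.
move=> algM leviS P; have [sSM algS ssS _ _] := leviS.
have pS := semisimple_perfect iota algS ssS.
have sSP : (S <= P)%VS by apply: lie_perfect_sub_radical.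
have [[idP /eqP pP] _] := perfect_radicalP M; rewrite -/P in idP pP.
have algP : lie_subalgebra P by rewrite /lie_subalgebra pP.
have [leviP defT] := levi_factor_cap idP leviS sSP.
have [_ _ _ defP trivTS] := leviP.
have [[idT solT] maxT] := lie_radicalP P.
have [[idN nilN] maxN] := lie_nilradicalP algP.
set T := lie_radical P in defT defP trivTS idT solT maxT *.
set N := lie_nilradical P in idN nilN maxN *.
have [sTP sPT] := andP idT.
(* [P = [P, P]] is contained in [[P, T] + S], and [T] meets [S] trivially *)
have pT : lie_prodv P T = T.
  apply/eqP; rewrite eqEsubv sPT /=.
  have sP : (P <= lie_prodv P T + S)%VS.
    rewrite -{1}pP -{2}defP lie_prodvDr subv_add addvSl /=.
    rewrite -{1}defP lie_prodvDl subv_add lie_prodvC.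
    rewrite (subv_trans (lie_prodvS sSP (subvv _)) (addvSl _ _)) /=.
    exact: subv_trans algS (addvSr _ _).
  rewrite -{1}(capv_idPr sTP); apply: subv_trans (capvS sP (subvv _)) _.
  by rewrite -vspace_modl // (capvC S) trivTS addv0.
have nilT : lie_nilpotent T.
  by rewrite -pT; apply: (lie_nilpotent_prodv_solvable iota).
have sTN : (T <= N)%VS by apply: maxN.
split=> //; split=> //; first by rewrite -defT.
apply/eqP; rewrite eqEsubv sTN; apply: maxT; split=> //.
apply: lie_nilpotent_solvable nilN.
have [sNP sPN] := andP idN.
exact: subv_trans (lie_prodvS sNP (subvv _)) sPN.
Qed.

Theorem theorem2p6 (R : realType) (F : fieldType) (hF : real_or_complex R F)
    (L : lieAlgType F) (S : {vspace L}) (hS : levi_factor {: L} S) :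
  let P := perfect_radical {: L} in
  [/\ (* (a) *) (S <= P)%VS,
      (* (b) *) levi_factor P S
    & (* (c) *)
      [/\ lie_radical P = (lie_radical {: L} :&: P)%VS,
          (lie_radical {: L} :&: P <= lie_nilradical P)%VS,
          lie_radical P = lie_nilradical P
        & lie_nilpotent (lie_radical P)]].
Proof.
case: hF L S hS => L S.
- by apply: (levi_factor_perfect_radical (real_complex R)); apply: subvf.
- by apply: (levi_factor_perfect_radical (@idfun (complex R))); apply: subvf.
Qed.
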